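(* Let $n\in\mathbb N$, $n\geq 1$, let $g$ be a left-invariant Riemannian metric on the Heisenberg group $H_{2n+1}$ determined by an inner product $B$ on $\mathfrak h_{2n+1}$, and let $(Z,E_1,F_1,\dots,E_n,F_n)$ be a positively oriented $B$-orthonormal basis of $\mathfrak h_{2n+1}$ satisfying, for some $(a_1,\dots,a_n)\in\mathbb R_{>0}^n$ and all $1\le p,q\le n$, $$[E_p,F_q]=\delta_{p,q}\,a_p Z,\qquad [E_p,Z]=[F_p,Z]=[E_p,E_q]=[F_p,F_q]=0 .$$ Then the invariant spinor on $(H_{2n+1},g)$ determined by $1\in\Sigma$ (where $\Sigma$ is built from the orthonormal basis $(e_1,e_2,e_3,\dots,e_{2n},e_{2n+1})=(Z,E_1,F_1,\dots,E_n,F_n)$) is a generalised Killing spinor with the following set of eigenvalues: $$\Big\{\lambda_p=\tfrac14 a_p\ (p=1,\dots,n),\quad \mu=-\sum_{q=1}^n\lambda_q\Big\}.$$ In particular, choosing $a_p:=p$ for each $p$, there are $n+1$ distinct constant eigenvalues.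
   Context: Heisenberg group. $H_{2n+1}$ is the Lie group of real $(n+2)\times(n+2)$ matrices $\begin{pmatrix}1&v^T&x\\0&\mathrm{Id}_n&w\\0&0&1\end{pmatrix}$ with $v,w\in\mathbb R^n$, $x\in\mathbb R$. Its Lie algebra $\mathfrak h_{2n+1}$ has basis $\hat Z$ (only non-zero entry a $1$ in position $(1,n+2)$), $\hat E_p$ (only non-zero entry a $1$ in position $(1,p+1)$), $\hat F_p$ (only non-zero entry a $1$ in position $(p+1,n+2)$), $1\le p\le n$, with $[\hat E_p,\hat F_q]=\delta_{p,q}\hat Z$ and all other brackets of basis elements zero (up to antisymmetry). The orientation is the one determined by the ordered basis $(\hat Z,\hat E_1,\hat F_1,\dots,\hat E_n,\hat F_n)$. Every inner product on $\mathfrak h_{2n+1}$ admits a positively oriented orthonormal basis as in the claim for some $(a_1,\dots,a_n)\in\mathbb R^n_{>0}$, and every $(a_1,\dots,a_n)\in\mathbb R^n_{>0}$ arises: take the inner product for which $(\hat Z,a_1\hat E_1,\hat F_1,\dots,a_n\hat E_n,\hat F_n)$ is orthonormal. Spinors. Let $G$ be a connected $(2n+1)$-dimensional oriented Lie group with left-invariant metric $g$ induced by an inner product $B$ on $\mathfrak g$, and $(e_1,\dots,e_{2n+1})$ a positively oriented $B$-orthonormal basis, identified with left-invariant vector fields. Put $x_p=\frac1{\sqrt2}(e_{2p}-ie_{2p+1})$, $y_p=\frac1{\sqrt2}(e_{2p}+ie_{2p+1})$ in $\mathfrak g^{\mathbb C}$, $L'=\mathrm{span}_{\mathbb C}\{y_1,\dots,y_n\}$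 and $\Sigma=\Lambda^\bullet L'$ (exterior algebra, of complex dimension $2^n$). Clifford multiplication on $\Sigma$ is $$e_1\cdot\eta=i(\eta_{\mathrm{even}}-\eta_{\mathrm{odd}}),\quad e_{2p}\cdot\eta=i(x_p\lrcorner\eta+y_p\wedge\eta),\quad e_{2p+1}\cdot\eta=y_p\wedge\eta-x_p\lrcorner\eta,$$ where $x_p\lrcorner$ is the contraction (antiderivation of degree $-1$) with $x_p\lrcorner y_q=\delta_{pq}$. Thus $v\cdot v\cdot\eta=-B(v,v)\eta$. The spin structure used is the $G$-invariant one, i.e. the trivial one determined by the left-invariant frame; the spinor bundle is $G\times\Sigma$, spinors are smooth maps $G\to\Sigma$, and a spinor is invariant if it is constant, so invariant spinors are identified with elements of $\Sigma$. The spin connection $\widetilde\nabla^g$ is the lift of the Levi-Civita connection $\nabla^g$; for an invariant spinor $\psi\in\Sigma$ and $X\in\mathfrak g$, $\widetilde\nabla^g_X\psi=\frac12\sum_{i<j}g(\nabla^g_Xe_i,e_j)\,e_i\cdot e_j\cdot\psi$. Generalised Killing spinors. A spinor $\psi$ is generalised Killing if there is a $g$-symmetric endomorphism field $A$ of $TG$ with $\widetilde\nabla^g_X\psi=A(X)\cdot\psi$ for every vector field $X$. The eigenvalues of (a non-zero) $\psi$ are the eigenvalues of $A$. *)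

(* Defs.v *)
From HB Require Import structures.
From mathcomp Require Import all_boot all_order all_algebra.
From mathcomp Require Import all_classical all_reals all_analysis.
From mathcomp Require Import complex ring.

Set Implicit Arguments.
Unset Strict Implicit.
Unset Printing Implicit Defensive.

Import Order.TTheory GRing.Theory Num.Theory.
Import numFieldNormedType.Exports.

Local Open Scope classical_set_scope.
Local Open Scope ring_scope.
Local Open Scope complex_scope.

(** * Frames *)

(* The ordered family (Z, E_1, F_1, ..., E_n, F_n).  With indices starting from
   0 and p : 'I_n, E p and F p sit at positions 2p+1 and 2p+2. *)
Definition frame_seq (V : Type) (n : nat) (Z : V) (E F : 'I_n -> V) : seq V :=
  Z :: flatten [seq [:: E p; F p] | p <- enum 'I_n].

Lemma frame_size (V : Type) (n : nat) (Z : V) (E F : 'I_n -> V) :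
  size (frame_seq Z E F) == n.*2.+1.
Proof.
rewrite /frame_seq /= eqSS size_flatten /shape -map_comp.
rewrite (eq_map (g := fun=> 2%N)) // sumnE big_map big_enum /=.
by rewrite sum_nat_const card_ord muln2.
Qed.

Definition frame (V : Type) (n : nat) (Z : V) (E F : 'I_n -> V) :
  (n.*2.+1).-tuple V := Tuple (frame_size Z E F).

Lemma mem_frame (V : eqType) (n : nat) (Z : V) (E F : 'I_n -> V) (x : V) :
  x \in frame Z E F -> x = Z \/ exists p, x = E p \/ x = F p.
Proof.
rewrite inE => /predU1P[->|]; first by left.
move=> /flattenP[s /mapP[p _ ->]]; rewrite !inE => /orP[] /eqP ->; right; exists p; by [left|right].
Qed.
Lemma frame_mem (V : eqType) (n : nat) (Z : V) (E F : 'I_n -> V) :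
  Z \in frame Z E F /\ forall p, E p \in frame Z E F /\ F p \in frame Z E F.
Proof.
split; first by rewrite inE eqxx.
move=> p; split; rewrite inE; apply/orP; right; apply/flattenP;
 (exists [:: E p; F p]; first by apply/map_f; rewrite mem_enum);
 by rewrite !inE eqxx ?orbT.
Qed.

Lemma frame_nth (V : Type) (n : nat) (x0 Z : V) (E F : 'I_n -> V) (p : 'I_n) :
  nth x0 (frame Z E F) p.*2.+1 = E p /\ nth x0 (frame Z E F) p.*2.+2 = F p.
Proof.
have H (s : seq 'I_n) k q : nth q s k = p -> (k < size s)%N ->
  nth x0 (flatten [seq [:: E p; F p] | p <- s]) k.*2 = E p /\
  nth x0 (flatten [seq [:: E p; F p] | p <- s]) k.*2.+1 = F p.
  elim: s k => [|r s IH] [|k] //=.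
    by move=> ->.
  by move=> /IH{}IH ks; apply: IH.
rewrite /=; apply: (H _ _ p); last by rewrite size_enum_ord.
by rewrite nth_ord_enum.
Qed.


(** * The Heisenberg group and its Lie algebra *)

(* Indices of the first row / last column and of the p-th middle row / column
   in the block decomposition 1 + (n + 1). *)
Definition ifst (n : nat) : 'I_(1 + (n + 1)) := lshift (n + 1) ord0.
Definition imid (n : nat) (p : 'I_n) : 'I_(1 + (n + 1)) := rshift 1 (lshift 1 p).
Definition ilst (n : nat) : 'I_(1 + (n + 1)) := rshift 1 (rshift n ord0).

Definition heis_mx (R : realType) (n : nat) (v w : 'cV[R]_n) (x : R) :
    'M[R]_(1 + (n + 1)) :=
  block_mx 1%:M (row_mx v^T x%:M)
           0    (block_mx 1%:M w
                          0    1%:M).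

Definition heis_group (R : realType) (n : nat) : set 'M[R]_(1 + (n + 1)) :=
  [set h | exists v w x, h = heis_mx v w x].

Definition hatZ (R : realType) (n : nat) : 'M[R]_(1 + (n + 1)) :=
  delta_mx (ifst n) (ilst n).
Definition hatE (R : realType) (n : nat) (p : 'I_n) : 'M[R]_(1 + (n + 1)) :=
  delta_mx (ifst n) (imid p).
Definition hatF (R : realType) (n : nat) (p : 'I_n) : 'M[R]_(1 + (n + 1)) :=
  delta_mx (imid p) (ilst n).

Definition hat_frame (R : realType) (n : nat) :=
  frame (hatZ R n) (@hatE R n) (@hatF R n).

Definition heis_alg (R : realType) (n : nat) : {vspace 'M[R]_(1 + (n + 1))} :=
  <<hat_frame R n>>%VS.

Notation heis R n := (subvs_of (heis_alg R n)).

(* The commutator of matrices; [lie_bracketE] below shows that the projection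
   onto the Lie algebra does nothing. *)
Definition lie_bracket (R : realType) (n : nat) (X Y : heis R n) : heis R n :=
  vsproj (heis_alg R n) (vsval X *m vsval Y - vsval Y *m vsval X).

Lemma hat_mul (R : realType) (n : nat) :
  [/\ forall p q : 'I_n, hatE R p *m hatF R q = (p == q)%:R *: hatZ R n,
      forall X, X \in hat_frame R n -> hatZ R n *m X = 0 /\ X *m hatZ R n = 0,
      forall p q : 'I_n, hatE R p *m hatE R q = 0, 
      forall p q : 'I_n, hatF R p *m hatF R q = 0 &
      forall p q : 'I_n, hatF R p *m hatE R q = 0].
Proof.
have fl : (ifst n == ilst n) = false by [].
have lf : (ilst n == ifst n) = false by [].
have mf (p : 'I_n) : (imid p == ifst n) = false by [].
have fm (p : 'I_n) : (ifst n == imid p) = false by [].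
have ml (p : 'I_n) : (imid p == ilst n) = false.
  by rewrite /imid /ilst (inj_eq (@rshift_inj _ _)) eq_lrshift.
have lm (p : 'I_n) : (ilst n == imid p) = false by rewrite eq_sym ml.
split.
- move=> p q; rewrite /hatE /hatF mul_delta_mx_cond /imid.
  by rewrite (inj_eq (@rshift_inj _ _)) (inj_eq (@lshift_inj _ _)) scaler_nat.
- by move=> X /mem_frame[->|[p [->|->]]];
    rewrite /hatZ /hatE /hatF !mul_delta_mx_cond ?fl ?lf ?mf ?fm ?ml ?lm.
- by move=> p q; rewrite /hatE mul_delta_mx_cond mf.
- by move=> p q; rewrite /hatF mul_delta_mx_cond lm.
- by move=> p q; rewrite /hatE /hatF mul_delta_mx_cond lf.
Qed.

Lemma lie_bracketE (R : realType) (n : nat) (X Y : heis R n) :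
  vsval (lie_bracket X Y) = vsval X *m vsval Y - vsval Y *m vsval X.
Proof.
have mulV A C : A \in hat_frame R n -> C \in hat_frame R n ->
    A *m C \in heis_alg R n.
  have [EF ZZ EE FF FE] := hat_mul R n.
  have [Zin _] := frame_mem (hatZ R n) (@hatE R n) (@hatF R n).
  move=> /[dup] hA /mem_frame[->|[p [->|->]]].
  - by move=> /ZZ[-> _]; rewrite mem0v.
  - move=> /mem_frame[->|[q [->|->]]]; rewrite ?EF ?EE ?FE ?mem0v//.
      by have [] := frame_mem (hatZ R n) (@hatE R n) (@hatF R n) => _ /(_ p)[/ZZ[_ ->] _]; rewrite mem0v.
    by rewrite memvZ// memv_span.
  - move=> /mem_frame[->|[q [->|->]]]; rewrite ?FF ?FE ?mem0v//.
    by have [] := frame_mem (hatZ R n) (@hatE R n) (@hatF R n) => _ /(_ p)[_ /ZZ[_ ->]]; rewrite mem0v.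
have mulA A C : A \in heis_alg R n -> C \in heis_alg R n ->
    A *m C \in heis_alg R n.
  move=> /coord_span -> /coord_span ->.
  rewrite mulmx_suml memv_suml// => i _; rewrite mulmx_sumr memv_suml// => j _.
  by rewrite -scalemxAl -scalemxAr !memvZ// mulV// mem_nth// size_tuple.
by rewrite vsprojK// memvB// mulA// subvsP.
Qed.

Definition positively_oriented (R : realType) (n : nat)
    (e : (n.*2.+1).-tuple (heis R n)) : Prop :=
  0 < \det (\matrix_(i, j) coord (hat_frame R n) j (vsval (tnth e i))).

(** * Inner products and the Levi-Civita connection *)

Definition inner_product (R : realType) (V : lmodType R) (B : V -> V -> R) :=
  [/\ forall c x y z, B (c *: x + y) z = c * B x z + B y z,
      forall x y, B x y = B y x
    & forall x, x != 0 -> 0 < B x x].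

Definition orthonormal_frame (R : realType) (V : lmodType R) (B : V -> V -> R)
    (m : nat) (e : m.-tuple V) : Prop :=
  forall i j, B (tnth e i) (tnth e j) = (i == j)%:R.

(* The Levi-Civita connection of the left-invariant metric given by [B],
   restricted to left-invariant vector fields: [B X Y] is then a constant
   function, so being metric means that [nabla X] is skew for [B]. *)
Definition levi_civita (R : realType) (n : nat)
    (B : heis R n -> heis R n -> R)
    (nabla : heis R n -> heis R n -> heis R n) : Prop :=
  [/\ forall c X Y W, nabla (c *: X + Y) W = c *: nabla X W + nabla Y W,
      forall c X Y W, nabla W (c *: X + Y) = c *: nabla W X + nabla W Y,
      forall X Y, nabla X Y - nabla Y X = lie_bracket X Y
    & forall X Y W, B (nabla X Y) W + B Y (nabla X W) = 0].

Lemma orthonormal_expand (R : realType) (n : nat) (B : heis R n -> heis R n -> R)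
    (e : (n.*2.+1).-tuple (heis R n)) (v : heis R n) :
  inner_product B -> orthonormal_frame B e ->
  v = \sum_(k < n.*2.+1) B v (tnth e k) *: tnth e k.
Proof.
move=> [lin sym _] on.
have B0 w : B 0 w = 0.
  by have /eqP := lin 1 0 0 w; rewrite scaler0 addr0 mul1r -subr_eq subrr eq_sym => /eqP.
have BD x y w : B (x + y) w = B x w + B y w by have := lin 1 x y w; rewrite scale1r mul1r.
have BZ c x w : B (c *: x) w = c * B x w by have := lin c x 0 w; rewrite addr0 B0 addr0.
have Bsum (c : 'I_n.*2.+1 -> R) j : B (\sum_k c k *: tnth e k) (tnth e j) = c j.
  transitivity (\sum_k c k * B (tnth e k) (tnth e j)).
    by elim/big_rec2: _ => [|k y1 y2 _ <-]; rewrite ?B0// BD BZ.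
  rewrite (bigD1 j)//= on eqxx mulr1 big1 ?addr0// => k /negbTE kj.
  by rewrite on kj mulr0.
have fr : free e.
  apply/freeP => c c0 j; rewrite -(Bsum c j) -[RHS](B0 (tnth e j)); congr B.
  by rewrite -[RHS]c0; apply: eq_bigr => k _; rewrite (tnth_nth 0).
have bas : basis_of fullv e.
  rewrite basisEfree fr subvf /= dimvf size_tuple.
  by apply: leq_trans (dim_span _) _; rewrite size_tuple.
have ve := coord_basis bas (memvf v).
rewrite {1}ve; apply: eq_bigr => k _; rewrite -(tnth_nth 0); congr (_ *: _).
transitivity (B (\sum_i coord e i v *: tnth e i) (tnth e k)); first by rewrite Bsum.
by rewrite {2}ve; congr B; apply: eq_bigr => i _; rewrite (tnth_nth 0).
Qed.

Lemma levi_civita_exists (R : realType) (n : nat) (B : heis R n -> heis R n -> R)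
    (e : (n.*2.+1).-tuple (heis R n)) :
  inner_product B -> orthonormal_frame B e -> exists nabla, levi_civita B nabla.
Proof.
move=> ip on; have expd v := orthonormal_expand v ip on.
case: (ip) => lin sym _.
have B0 w : B 0 w = 0.
  by have /eqP := lin 1 0 0 w; rewrite scaler0 addr0 mul1r -subr_eq subrr eq_sym => /eqP.
have BD x y w : B (x + y) w = B x w + B y w by have := lin 1 x y w; rewrite scale1r mul1r.
have BZ c x w : B (c *: x) w = c * B x w by have := lin c x 0 w; rewrite addr0 B0 addr0.
have brl c (X Y W : heis R n) : lie_bracket (c *: X + Y) W = c *: lie_bracket X W + lie_bracket Y W.
  rewrite /lie_bracket -linearP; congr vsproj => /=; rewrite mulmxDl mulmxDr -scalemxAl -scalemxAr.
  by rewrite scalerBr opprD addrACA.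
have brC (X Y : heis R n) : lie_bracket X Y = - lie_bracket Y X.
  by rewrite /lie_bracket -[X in vsproj _ X]opprB linearN.
have brr c (X Y W : heis R n) : lie_bracket W (c *: X + Y) = c *: lie_bracket W X + lie_bracket W Y.
  by rewrite brC brl opprD -scalerN -!brC.
have [K KE] : exists K, forall X Y W, K X Y W =
    2^-1 * (B (lie_bracket X Y) W - B (lie_bracket Y W) X + B (lie_bracket W X) Y).
  by eexists (fun X Y W => _).
pose nabla X Y := \sum_(k < n.*2.+1) K X Y (tnth e k) *: tnth e k.
have Kl1 c X X' Y W : K (c *: X + X') Y W = c * K X Y W + K X' Y W.
  by rewrite !KE brl brr (sym _ (c *: X + X')) !lin !(sym (lie_bracket Y W)); ring.
have Kl2 c X X' Y W : K Y (c *: X + X') W = c * K Y X W + K Y X' W.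
  by rewrite !KE brl brr (sym _ (c *: X + X')) !lin !(sym _ (lie_bracket W Y)); ring.
have Kl3 c X X' Y W : K Y W (c *: X + X') = c * K Y W X + K Y W X'.
  by rewrite !KE brl brr (sym _ (c *: X + X')) !lin !(sym _ (lie_bracket Y W)); ring.
have K0 Y W : K Y W 0 = 0.
  by have /eqP := Kl3 1 0 0 Y W; rewrite scaler0 addr0 mul1r -subr_eq subrr eq_sym => /eqP.
have nablaE X Y W : B (nabla X Y) W = K X Y W.
  rewrite [in RHS](expd W) /nabla.
  transitivity (\sum_(k < n.*2.+1) B W (tnth e k) * K X Y (tnth e k)).
    rewrite (eq_bigr (fun k => K X Y (tnth e k) * B (tnth e k) W)).
      by elim/big_rec2: _ => [|k y1 y2 _ <-]; rewrite ?B0// BD BZ.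
    by move=> k _; rewrite mulrC sym.
  elim/big_rec2: _ => [|k y1 y2 _ IH]; first by rewrite K0.
  by rewrite IH; exact/esym/Kl3.
have BN x w : B (- x) w = - B x w by rewrite -scaleN1r BZ mulN1r.
have inj x y : (forall w, B x w = B y w) -> x = y.
  by move=> H; rewrite (expd x) (expd y); apply: eq_bigr => k _; rewrite H.
exists nabla; split.
- by move=> c X Y W; apply: inj => U; rewrite lin !nablaE Kl1.
- by move=> c X Y W; apply: inj => U; rewrite lin !nablaE Kl2.
- move=> X Y; apply: inj => U; rewrite BD BN !nablaE !KE.
  by rewrite (brC Y X) (brC U X) (brC U Y) !BN; field.
- move=> X Y W; rewrite (sym Y) !nablaE !KE.
  by rewrite (brC W X) (brC W Y) (brC Y X) !BN; field.
Qed.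

(** * Spinors *)

(* Sigma = exterior algebra of L' = span (y_1, ..., y_n): [eta S] is the
   coefficient of y_S, the product of the y_p with p in S taken in increasing
   order. *)
Notation Sigma R n := {ffun {set 'I_n} -> R[i]}.

(* (-1)^(number of q in S with q < p): the sign in
   y_p /\ y_S = wsign S p y_(S u {p}) for p notin S, and in the contraction of
   y_S by x_p for p in S. *)
Definition wsign (R : realType) (n : nat) (S : {set 'I_n}) (p : 'I_n) : R[i] :=
  (-1) ^+ #|[set q in S | (q < p)%N]|.

Definition ywedge (R : realType) (n : nat) (p : 'I_n) (eta : Sigma R n) :
    Sigma R n :=
  [ffun S : {set 'I_n} => if p \in S then wsign R S p * eta (S :\ p) else 0].

Definition xcontract (R : realType) (n : nat) (p : 'I_n) (eta : Sigma R n) :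
    Sigma R n :=
  [ffun S : {set 'I_n} => if p \in S then 0 else wsign R S p * eta (p |: S)].

Definition even_part (R : realType) (n : nat) (eta : Sigma R n) : Sigma R n :=
  [ffun S : {set 'I_n} => if odd #|S| then 0 else eta S].
Definition odd_part (R : realType) (n : nat) (eta : Sigma R n) : Sigma R n :=
  [ffun S : {set 'I_n} => if odd #|S| then eta S else 0].

Definition sigma_one (R : realType) (n : nat) : Sigma R n :=
  [ffun S : {set 'I_n} => (S == finset.set0)%:R].

Lemma wsignD1 (R : realType) (n : nat) (S : {set 'I_n}) (p q : 'I_n) :
  q \in S -> wsign R (S :\ q) p = (-1) ^+ (q < p)%N * wsign R S p.
Proof.
move=> qS; rewrite /wsign; case: (boolP (q < p)%N) => qp; last first.
  rewrite expr0 mul1r; congr (_ ^+ _); apply: eq_card => r; rewrite !inE.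
  by case: eqVneq => //= ->; rewrite (negbTE qp) andbF.
rewrite [in RHS](cardsD1 q) !inE qS qp /= add1n expr1 exprS mulrA mulrNN !mul1r.
by congr (_ ^+ _); apply: eq_card => r; rewrite !inE andbA.
Qed.

Lemma wsignU1 (R : realType) (n : nat) (S : {set 'I_n}) (p q : 'I_n) :
  q \notin S -> wsign R (q |: S) p = (-1) ^+ (q < p)%N * wsign R S p.
Proof.
move=> qS; have := wsignD1 R p (setU11 q S); rewrite finset.setU1K// => ->.
by rewrite mulrA -expr2 sqrr_sign mul1r.
Qed.

Lemma wsign_sq (R : realType) (n : nat) (S : {set 'I_n}) (p : 'I_n) :
  wsign R S p * wsign R S p = 1.
Proof. by rewrite -expr2 sqrr_sign. Qed.

Lemma ltn_sign (R : realType) (n : nat) (p q : 'I_n) : p != q ->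
  (-1) ^+ (p < q)%N = - (-1) ^+ (q < p)%N :> R[i].
Proof. by move=> /eqP pq; case: (ltngtP p q) => [_|_|/val_inj]; rewrite ?opprK. Qed.

(* The relations that determine exterior multiplication by the y_p and the
   antiderivations contracting with the x_p. *)
Lemma ywedgeC (R : realType) (n : nat) (p q : 'I_n) (eta : Sigma R n) :
  ywedge p (ywedge q eta) = - ywedge q (ywedge p eta).
Proof.
apply/ffunP => S; rewrite !ffunE !inE; have [->|pq] := eqVneq p q.
  by rewrite /= mulr0 if_same oppr0.
rewrite /=; case: (boolP (p \in S)) => pS; case: (boolP (q \in S)) => qS;
  rewrite ?mulr0 ?oppr0//.
rewrite !wsignD1// (ltn_sign _ pq) [in RHS]finset.setDDl finset.setUC -finset.setDDl; ring.
Qed.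

Lemma xcontract_one (R : realType) (n : nat) (p : 'I_n) :
  xcontract p (sigma_one R n) = 0.
Proof.
apply/ffunP => S; rewrite !ffunE; case: ifP => // _.
suff /negbTE-> : p |: S != finset.set0 by rewrite mulr0.
by apply/set0Pn; exists p; rewrite setU11.
Qed.

Lemma xcontract_ywedge (R : realType) (n : nat) (p q : 'I_n) (eta : Sigma R n) :
  xcontract p (ywedge q eta) = (p == q)%:R *: eta - ywedge q (xcontract p eta).
Proof.
apply/ffunP => S; rewrite !ffunE !inE; have [<-|pq] := eqVneq p q.
  rewrite /= scale1r; case: (boolP (p \in S)) => pS.
    by rewrite finset.setD1K// wsignD1// ltnn mul1r mulrA wsign_sq mul1r subrr.
  by rewrite finset.setU1K// wsignU1// ltnn mul1r mulrA wsign_sq mul1r subr0.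
rewrite scale0r add0r /=.
case: (boolP (p \in S)) => pS; case: (boolP (q \in S)) => qS;
  rewrite ?mulr0 ?oppr0//.
rewrite wsignU1// wsignD1// (ltn_sign _ pq).
have -> : (p |: S) :\ q = p |: S :\ q.
  by apply/finset.setP => r; rewrite !inE; case: (eqVneq r p) => //= ->; rewrite pq.
ring.
Qed.

(* Clifford multiplication by [v], extended linearly from the orthonormal
   basis [e]. *)
Definition clifford (R : realType) (n : nat) (V : lmodType R)
    (B : V -> V -> R) (e : (n.*2.+1).-tuple V) (v : V) (eta : Sigma R n) :
    Sigma R n :=
  (B v e`_0)%:C *: ('i *: (even_part eta - odd_part eta))
  + \sum_(p < n)
      ((B v e`_(p.*2.+1))%:C *: ('i *: (xcontract p eta + ywedge p eta))
       + (B v e`_(p.*2.+2))%:C *: (ywedge p eta - xcontract p eta)).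

(** * Spinor fields on the Heisenberg group

   Functions on the group are represented by functions on matrices, of which
   only the values on [heis_group] matter.  The tangent bundle is trivialised
   by left translations: [X : heis R n] stands for the tangent vector [h *m X]
   at [h]. *)

Fixpoint Ck (R : realType) (V : normedModType R) (k : nat) (f : V -> R) : Prop :=
  continuous f /\
  if k is k'.+1 then
    forall v, (forall x, derivable f x v) /\ Ck k' (fun x => 'D_v f x)
  else True.

(* Smoothness in the global chart [heis_mx]. *)
Definition heis_smooth (R : realType) (n : nat)
    (f : 'M[R]_(1 + (n + 1)) -> R) : Prop :=
  forall k, Ck k (fun c : 'cV[R]_n * 'cV[R]_n * R => f (heis_mx c.1.1 c.1.2 c.2)).

Definition smooth_spinor (R : realType) (n : nat)
    (psi : 'M[R]_(1 + (n + 1)) -> Sigma R n) : Prop :=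
  forall S, heis_smooth (fun h => complex.Re (psi h S)) /\
            heis_smooth (fun h => complex.Im (psi h S)).

Definition invariant_spinor (R : realType) (n : nat) (eta : Sigma R n) :
  'M[R]_(1 + (n + 1)) -> Sigma R n := fun=> eta.

(* The derivative of the Sigma-valued function [psi] along the left-invariant
   vector field [X]; since the group is 1 + heis_alg, t |-> h (1 + t X) is a
   curve in the group with velocity [h *m X] at [h]. *)
Definition spinor_deriv (R : realType) (n : nat)
    (psi : 'M[R]_(1 + (n + 1)) -> Sigma R n)
    (h : 'M[R]_(1 + (n + 1))) (X : heis R n) : Sigma R n :=
  [ffun S : {set 'I_n} =>
    derive1 (fun t : R => complex.Re (psi (h *m (1%:M + t *: vsval X)) S)) 0 +i*
    derive1 (fun t : R => complex.Im (psi (h *m (1%:M + t *: vsval X)) S)) 0].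

Definition spin_connection (R : realType) (n : nat)
    (B : heis R n -> heis R n -> R) (nabla : heis R n -> heis R n -> heis R n)
    (e : (n.*2.+1).-tuple (heis R n))
    (psi : 'M[R]_(1 + (n + 1)) -> Sigma R n)
    (h : 'M[R]_(1 + (n + 1))) (X : heis R n) : Sigma R n :=
  spinor_deriv psi h X
  + 2^-1 *: \sum_(i < n.*2.+1) \sum_(j < n.*2.+1 | (i < j)%N)
      (B (nabla X (tnth e i)) (tnth e j))%:C *:
        clifford B e (tnth e i) (clifford B e (tnth e j) (psi h)).

Definition symmetric_endo_field (R : realType) (n : nat)
    (B : heis R n -> heis R n -> R) (e : (n.*2.+1).-tuple (heis R n))
    (A : 'M[R]_(1 + (n + 1)) -> 'End(heis R n)) : Prop :=
  (forall i j, heis_smooth (fun h => B (A h (tnth e i)) (tnth e j))) /\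
  (forall h, heis_group h -> forall X Y, B (A h X) Y = B X (A h Y)).

Definition killing_endo (R : realType) (n : nat)
    (B : heis R n -> heis R n -> R) (nabla : heis R n -> heis R n -> heis R n)
    (e : (n.*2.+1).-tuple (heis R n))
    (psi : 'M[R]_(1 + (n + 1)) -> Sigma R n)
    (A : 'M[R]_(1 + (n + 1)) -> 'End(heis R n)) : Prop :=
  symmetric_endo_field B e A /\
  (forall h, heis_group h -> forall X,
     spin_connection B nabla e psi h X = clifford B e (A h X) (psi h)).

Definition generalised_killing (R : realType) (n : nat)
    (B : heis R n -> heis R n -> R) (nabla : heis R n -> heis R n -> heis R n)
    (e : (n.*2.+1).-tuple (heis R n))
    (psi : 'M[R]_(1 + (n + 1)) -> Sigma R n) : Prop :=
  smooth_spinor psi /\ exists A, killing_endo B nabla e psi A.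

(* The eigenvalues of the generalised Killing spinor [psi] are constant and
   form the set [L].  The endomorphism field is unique when [psi] has no zero. *)
Definition constant_eigenvalues (R : realType) (n : nat)
    (B : heis R n -> heis R n -> R) (nabla : heis R n -> heis R n -> heis R n)
    (e : (n.*2.+1).-tuple (heis R n))
    (psi : 'M[R]_(1 + (n + 1)) -> Sigma R n) (L : set R) : Prop :=
  forall A, killing_endo B nabla e psi A ->
  forall h, heis_group h -> [set l | passmx.leigenvalue (A h) l] = L.

(** * Adapted bases *)

Definition heis_basis (R : realType) (n : nat) (B : heis R n -> heis R n -> R)
    (Z : heis R n) (E F : 'I_n -> heis R n) (a : 'I_n -> R) : Prop :=
  [/\ orthonormal_frame B (frame Z E F),
      positively_oriented (frame Z E F),
      forall p q, lie_bracket (E p) (F q) = ((p == q)%:R * a p) *: Z,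
      forall p, lie_bracket (E p) Z = 0 /\ lie_bracket (F p) Z = 0
    & forall p q, lie_bracket (E p) (E q) = 0 /\ lie_bracket (F p) (F q) = 0].

(* Main.v *)
Require Import Defs.
From HB Require Import structures.
From mathcomp Require Import all_boot all_order all_algebra.
From mathcomp Require Import all_classical all_reals all_analysis.
From mathcomp Require Import complex ring.

Set Implicit Arguments.
Unset Strict Implicit.
Unset Printing Implicit Defensive.

Import Order.TTheory GRing.Theory Num.Theory.
Import numFieldNormedType.Exports.

Local Open Scope classical_set_scope.
Local Open Scope card_scope.
Local Open Scope ring_scope.

(** By the Koszul formula, for every X the only non-zero coefficients
    g(nabla_X e_i, e_j) with i < j are
      g(nabla_X Z, E_q) = a_q g(X, F_q) / 2,
      g(nabla_X Z, F_q) = - a_q g(X, E_q) / 2,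
      g(nabla_X E_q, F_q) = - a_q g(X, Z) / 2.
    Since Z.E_q.1 = y_q, Z.F_q.1 = - i y_q and E_q.F_q.1 = i, the spin connection
    sends 1 to A(X).1, where A is diagonal in the frame with entries mu on Z and
    lambda_q on E_q and F_q.  The coefficients of v.1 on 1 and the y_q determine v,
    so A is the only endomorphism with this property. *)

(** * Positions in the frame and orthonormality *)

Lemma big_frame_index (V : nmodType) (n : nat) (f : nat -> V) :
  \sum_(i < n.*2.+1) f i = f 0%N + \sum_(p < n) (f p.*2.+1 + f p.*2.+2).
Proof.
rewrite big_ord_recl; congr (_ + _); elim: n => [|n IHn]; first by rewrite !big_ord0.
by rewrite doubleS !big_ord_recr/= IHn addrA.
Qed.

Lemma frame_index (n i : nat) : (i < n.*2.+1)%N ->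
  i = 0%N \/ exists p : 'I_n, i = p.*2.+1 \/ i = p.*2.+2.
Proof.
case: i => [|i]; [by left | rewrite ltnS => ilt; right].
have plt : (i./2 < n)%N by rewrite ltn_half_double.
(* Position 0 has been split off, so [i] is shifted by one: an even [i] is a position of [E], an odd
   one a position of [F]. *)
exists (Ordinal plt); rewrite /= -{1 3}(odd_double_half i).
by case: odd; [right|left].
Qed.

Lemma orthonormal_nth (R : realType) (V : lmodType R) (B : V -> V -> R) (m : nat)
    (e : m.-tuple V) (i j : nat) :
  orthonormal_frame B e -> (i < m)%N -> (j < m)%N -> B e`_i e`_j = (i == j)%:R.
Proof. by move=> /[swap] im /[swap] jm /(_ (Ordinal im) (Ordinal jm)); rewrite !(tnth_nth 0). Qed.

Section AdaptedFrame.
Local Open Scope complex_scope.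
Variables (R : realType) (n : nat).

(** Positions 2p+1 and 2q+2 have different parity. Hence the Kronecker symbol of positions is that
    of [p] and [q] inside one family and vanishes across the two families; symmetry of [B] gives the
    products in the other order. *)
Lemma orthonormal_frameP (V : lmodType R) (B : V -> V -> R) (Z : V) (E F : 'I_n -> V) :
  (forall x y, B x y = B y x) ->
  orthonormal_frame B (frame Z E F) <->
  [/\ B Z Z = 1,
      (forall p, B Z (E p) = 0), (forall p, B Z (F p) = 0),
      (forall p q, B (E p) (E q) = (p == q)%:R)
    & (forall p q, B (F p) (F q) = (p == q)%:R) /\
      (forall p q, B (E p) (F q) = 0)].
Proof.
move=> sym.
have h1 (p : 'I_n) : (p.*2.+1 < n.*2.+1)%N by rewrite ltnS ltn_double.
have h2 (p : 'I_n) : (p.*2.+2 < n.*2.+1)%N by rewrite ltnS -doubleS leq_double.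
have nth_frame := frame_nth 0 Z E F.
split=> [on|[ZZ ZE ZF EE [FF EF]]].
  split; [|move=> p|move=> p|move=> p q|split=> p q].
  - exact: (orthonormal_nth on (ltn0Sn _) (ltn0Sn _)).
  - by have := orthonormal_nth on (ltn0Sn _) (h1 p); rewrite (nth_frame p).1.
  - by have := orthonormal_nth on (ltn0Sn _) (h2 p); rewrite (nth_frame p).2.
  - have := orthonormal_nth on (h1 p) (h1 q).
    by rewrite !(nth_frame _).1 eqSS (inj_eq double_inj).
  - have := orthonormal_nth on (h2 p) (h2 q).
    by rewrite !(nth_frame _).2 !eqSS (inj_eq double_inj).
  - have := orthonormal_nth on (h1 p) (h2 q).
    rewrite (nth_frame _).1 (nth_frame _).2 => ->; case: eqP => // /(congr1 odd).
    by rewrite /= !odd_double.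
have key (i j : nat) : (i < n.*2.+1)%N -> (j < n.*2.+1)%N ->
    B (frame Z E F)`_i (frame Z E F)`_j = (i == j)%:R.
  have par (p q : 'I_n) : (p.*2 == q.*2.+1) = false.
    by apply/eqP => /(congr1 odd); rewrite /= !odd_double.
  move=> /frame_index[->|[p [->|->]]] /frame_index[->|[q [->|->]]];
    rewrite ?(nth_frame p).1 ?(nth_frame p).2 ?(nth_frame q).1 ?(nth_frame q).2;
    rewrite ?eqSS ?(inj_eq double_inj) ?par //; try by rewrite sym.
  by rewrite sym EF eq_sym par.
by move=> i j; rewrite !(tnth_nth 0) key.
Qed.

(** * The spinor 1 and the generators y_p of the exterior algebra *)

Definition sigma_y (p : 'I_n) : Sigma R n := [ffun S : {set 'I_n} => (S == [set p]%SET)%:R].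

Lemma ywedge_one p : ywedge p (sigma_one R n) = sigma_y p.
Proof.
apply/ffunP => S; rewrite !ffunE; case: ifPn => [pS|pS]; last first.
  by case: eqP => // SE; rewrite SE finset.inE eqxx in pS.
have [->|Sp] := eqVneq S [set p]%SET.
  (* The sign counts the elements of {p} strictly below p, and there are none. *)
  rewrite finset.setDv eqxx mulr1 /wsign eq_card0 ?expr0// => q; rewrite !inE.
  by case: eqP => //= ->; rewrite ltnn.
case: eqP => [/eqP|_]; last by rewrite mulr0.
by rewrite finset.setD_eq0 subset1 (negbTE Sp) => /eqP S0; rewrite S0 inE in pS.
Qed.

Lemma even_odd_one : even_part (sigma_one R n) - odd_part (sigma_one R n) = sigma_one R n.
Proof.
apply/ffunP => S; rewrite !ffunE; have [->|S0] := eqVneq S finset.set0.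
  by rewrite cards0 /= subr0.
by rewrite !if_same subrr.
Qed.

Lemma even_odd_y p : even_part (sigma_y p) - odd_part (sigma_y p) = - sigma_y p.
Proof.
apply/ffunP => S; rewrite !ffunE; have [->|S0] := eqVneq S [set p]%SET.
  by rewrite cards1 /= sub0r.
by rewrite !if_same subrr oppr0.
Qed.

Lemma even_partZ c (eta : Sigma R n) : even_part (c *: eta) = c *: even_part eta.
Proof. by apply/ffunP => S; rewrite !ffunE; case: ifP => _; rewrite ?scaler0. Qed.

Lemma odd_partZ c (eta : Sigma R n) : odd_part (c *: eta) = c *: odd_part eta.
Proof. by apply/ffunP => S; rewrite !ffunE; case: ifP => _; rewrite ?scaler0. Qed.

Lemma ywedgeZ p c (eta : Sigma R n) : ywedge p (c *: eta) = c *: ywedge p eta.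
Proof. by apply/ffunP => S; rewrite !ffunE; case: ifP => _; rewrite ?scaler0// [RHS]mulrCA. Qed.

Lemma xcontract_y p q : xcontract p (sigma_y q) = (p == q)%:R *: sigma_one R n.
Proof.
(* The antiderivation rule leaves the wedge of a contraction of 1, which is 0. Writing that 0 as a
   multiple by 0 lets homogeneity of the wedge remove it. *)
rewrite -ywedge_one xcontract_ywedge xcontract_one -(scale0r 0) ywedgeZ.
by rewrite scale0r subr0.
Qed.

Lemma ywedge_twice p (eta : Sigma R n) : ywedge p (ywedge p eta) = 0.
Proof. by apply/ffunP => S; rewrite !ffunE !inE eqxx /= mulr0 if_same. Qed.

(** All contractions kill 1, so only components of degree 0 and 1 survive. *)
Lemma clifford_one (V : lmodType R) (B : V -> V -> R) (e : (n.*2.+1).-tuple V) (v : V) :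
  clifford B e v (sigma_one R n) =
  ((B v e`_0)%:C * 'i) *: sigma_one R n +
  \sum_(p < n) ((B v e`_(p.*2.+1))%:C * 'i + (B v e`_(p.*2.+2))%:C) *: sigma_y p.
Proof.
rewrite /clifford even_odd_one scalerA; congr (_ + _); apply: eq_bigr => p _.
by rewrite xcontract_one ywedge_one add0r subr0 scalerA scalerDl.
Qed.

(** The coefficient on y_p has real part [f p] and imaginary part [d p]. As all the data are real,
    the action on 1 determines them; this is the source of the uniqueness of A. *)
Lemma sigma_comb_inj (c c' : R) (d d' f f' : 'I_n -> R) :
  (c%:C * 'i) *: sigma_one R n + \sum_p ((d p)%:C * 'i + (f p)%:C) *: sigma_y p =
  (c'%:C * 'i) *: sigma_one R n + \sum_p ((d' p)%:C * 'i + (f' p)%:C) *: sigma_y p ->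
  c = c' /\ forall p, d p = d' p /\ f p = f' p.
Proof.
have combE k (g h : 'I_n -> R) S :
    ((k%:C * 'i) *: sigma_one R n + \sum_p ((g p)%:C * 'i + (h p)%:C) *: sigma_y p) S =
    (k%:C * 'i) * (S == finset.set0)%:R +
    \sum_p ((g p)%:C * 'i + (h p)%:C) * (S == [set p]%SET)%:R.
  rewrite ffunE sum_ffunE; congr (_ + _); first by rewrite !ffunE.
  by apply: eq_bigr => p _; rewrite !ffunE.
have n0 p : (finset.set0 == [set p]%SET) = false.
  by apply/eqP => /finset.setP /(_ p); rewrite !inE eqxx.
move=> /ffunP eqS; split=> [|p].
  have := eqS finset.set0; rewrite !combE eqxx !mulr1.
  rewrite !big1; try by move=> p _; rewrite n0 mulr0.
  by rewrite !addr0 => /(mulIf (neq0Ci _)) [].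
have sumE (g h : 'I_n -> R) :
    \sum_q ((g q)%:C * 'i + (h q)%:C) * ([set p]%SET == [set q]%SET)%:R = (g p)%:C * 'i + (h p)%:C.
  rewrite (bigD1 p)//= eqxx mulr1 big1 ?addr0// => q /negbTE qp.
  by rewrite (inj_eq set1_inj) eq_sym qp mulr0.
have := eqS [set p]%SET; rewrite !combE eq_sym n0 !mulr0 !add0r !sumE.
rewrite -complexiE => /eqP; rewrite eq_complex /=.
by rewrite !(mulr0, mul0r, mulr1, oppr0, addr0, add0r) => /andP[/eqP -> /eqP ->].
Qed.
End AdaptedFrame.

(** * The Levi-Civita connection *)

Section InnerProduct.
Variables (R : realType) (V : lmodType R) (B : V -> V -> R).
Hypothesis ip : inner_product B.

Lemma innerC x y : B x y = B y x. Proof. by case: ip. Qed.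

Lemma inner0l x : B 0 x = 0.
Proof.
case: ip => /(_ 1 0 0 x) + _ _; rewrite scaler0 addr0 mul1r.
by move=> /eqP; rewrite -subr_eq subrr eq_sym => /eqP.
Qed.

Lemma innerDl x y z : B (x + y) z = B x z + B y z.
Proof. by case: ip => /(_ 1 x y z); rewrite scale1r mul1r. Qed.

Lemma innerZl c x y : B (c *: x) y = c * B x y.
Proof. by case: ip => /(_ c x 0 y); rewrite inner0l !addr0. Qed.

Lemma innerNl x y : B (- x) y = - B x y.
Proof. by rewrite -scaleN1r innerZl mulN1r. Qed.

Lemma inner_suml (I : finType) (f : I -> V) y : B (\sum_i f i) y = \sum_i B (f i) y.
Proof. exact: (big_morph (B^~ y) (fun x z => innerDl x z y) (inner0l y)). Qed.
End InnerProduct.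

Section LieBracket.
Variables (R : realType) (n : nat).
Implicit Types X Y W : heis R n.

Lemma lie_bracketC X Y : lie_bracket X Y = - lie_bracket Y X.
Proof. by rewrite /lie_bracket -[X in vsproj _ X]opprB linearN. Qed.

Lemma lie_bracketDl X Y W : lie_bracket (X + Y) W = lie_bracket X W + lie_bracket Y W.
Proof.
rewrite /lie_bracket -linearD; congr vsproj => /=.
by rewrite mulmxDl mulmxDr opprD addrACA.
Qed.

Lemma lie_bracketZl c X W : lie_bracket (c *: X) W = c *: lie_bracket X W.
Proof.
rewrite /lie_bracket -linearZ; congr vsproj => /=.
by rewrite -scalemxAl -scalemxAr scalerBr.
Qed.

Lemma lie_bracket0l W : lie_bracket 0 W = 0.
Proof. by rewrite -(scale0r 0) lie_bracketZl !scale0r. Qed.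

Lemma lie_bracket_suml (I : finType) (f : I -> heis R n) W :
  lie_bracket (\sum_i f i) W = \sum_i lie_bracket (f i) W.
Proof.
exact: (big_morph (fun X => lie_bracket X W) (fun X Y => lie_bracketDl X Y W) (lie_bracket0l W)).
Qed.
End LieBracket.

(** On left-invariant fields the metric is constant, so only the bracket terms of the Koszul formula
    remain. Replacing each bracket by its torsion-free expression gives six terms; skewness of
    [nabla] cancels four and makes the other two equal. *)
Lemma koszul (R : realType) (n : nat) (B : heis R n -> heis R n -> R)
    (nabla : heis R n -> heis R n -> heis R n) :
  inner_product B -> levi_civita B nabla -> forall X Y W,
  2 * B (nabla X Y) W =
  B (lie_bracket X Y) W - B (lie_bracket Y W) X + B (lie_bracket W X) Y.
Proof.
move=> ip [_ _ torsion metric] X Y W.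
have skew U T S : B (nabla U T) S = - B (nabla U S) T.
  by apply/eqP; rewrite -addr_eq0 (innerC ip (nabla U S)) metric.
rewrite -!torsion !(innerDl ip) !(innerNl ip).
by rewrite (skew X W Y) (skew Y X W) (skew W X Y); ring.
Qed.

Section AdaptedBasis.
Local Open Scope complex_scope.
Variables (R : realType) (n : nat) (B : heis R n -> heis R n -> R).
Variables (nabla : heis R n -> heis R n -> heis R n).
Variables (Z : heis R n) (E F : 'I_n -> heis R n) (a : 'I_n -> R).
Hypotheses (ip : inner_product B) (lc : levi_civita B nabla).
Hypothesis basis : heis_basis B Z E F a.
Implicit Types X : heis R n.
Local Notation e := (frame Z E F).

Let on : orthonormal_frame B e. Proof. by case: basis. Qed.

Lemma heis_expand X :
  X = B X Z *: Z + \sum_p (B X (E p) *: E p + B X (F p) *: F p).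
Proof.
rewrite [LHS](orthonormal_expand X ip on).
rewrite (eq_bigr (fun i : 'I__ => B X e`_i *: e`_i)); last by move=> i _; rewrite (tnth_nth 0).
rewrite (big_frame_index _ (fun i => B X e`_i *: e`_i)); congr (_ + _); apply: eq_bigr => p _.
by rewrite (frame_nth 0 Z E F p).1 (frame_nth 0 Z E F p).2.
Qed.

(** This is centrality of [Z]: the basis hypothesis gives it against [E p] and [F p], and expanding
    [X] in the frame extends it. *)
Lemma lie_bracketZr X : lie_bracket X Z = 0.
Proof.
have [_ _ _ brZ _] := basis.
have ZZ : lie_bracket Z Z = 0 by rewrite /lie_bracket subrr linear0.
rewrite (heis_expand X) lie_bracketDl lie_bracketZl ZZ scaler0 add0r lie_bracket_suml.
by rewrite big1 // => p _; rewrite lie_bracketDl !lie_bracketZl (brZ p).1 (brZ p).2 !scaler0 addr0.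
Qed.

(** Only the [F q] component of [X] fails to commute with [E q]; the sign comes from [F_q, E_q] = -
    a_q Z. *)
Lemma lie_bracketEr X q : lie_bracket X (E q) = - (a q * B X (F q)) *: Z.
Proof.
have [_ _ brEF brZ brEE] := basis.
rewrite {1}(heis_expand X) lie_bracketDl lie_bracketZl lie_bracketC (brZ q).1 oppr0 scaler0 add0r.
rewrite lie_bracket_suml (bigD1 q)//= big1 ?addr0 => [|p pq];
  rewrite lie_bracketDl !lie_bracketZl (brEE _ _).1 scaler0 add0r lie_bracketC brEF.
  by rewrite eqxx mul1r scalerN scalerA mulrC scaleNr.
by rewrite eq_sym (negbTE pq) mul0r scale0r oppr0 scaler0.
Qed.

Lemma lie_bracketFr X q : lie_bracket X (F q) = (a q * B X (E q)) *: Z.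
Proof.
have [_ _ brEF brZ brEE] := basis.
rewrite {1}(heis_expand X) lie_bracketDl lie_bracketZl lie_bracketC (brZ q).2 oppr0 scaler0 add0r.
rewrite lie_bracket_suml (bigD1 q)//= big1 ?addr0 => [|p pq];
  rewrite lie_bracketDl !lie_bracketZl (brEE _ _).2 scaler0 addr0 brEF.
  by rewrite eqxx mul1r scalerA mulrC.
by rewrite (negbTE pq) mul0r scale0r scaler0.
Qed.

Let BZZ : B Z Z = 1.
Proof. by have /orthonormal_frameP[|] := on; [exact: innerC|]. Qed.
Let BZE p : B Z (E p) = 0.
Proof. by have /orthonormal_frameP[|] := on; [exact: innerC|]. Qed.
Let BZF p : B Z (F p) = 0.
Proof. by have /orthonormal_frameP[|] := on; [exact: innerC|]. Qed.
Let BEE p q : B (E p) (E q) = (p == q)%:R.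
Proof. by have /orthonormal_frameP[|] := on; [exact: innerC|]. Qed.
Let BFF p q : B (F p) (F q) = (p == q)%:R.
Proof. by have /orthonormal_frameP[|? ? ? ? []] := on; [exact: innerC|]. Qed.
Let BEF p q : B (E p) (F q) = 0.
Proof. by have /orthonormal_frameP[|? ? ? ? []] := on; [exact: innerC|]. Qed.
Let BEZ p : B (E p) Z = 0. Proof. by rewrite innerC. Qed.
Let BFZ p : B (F p) Z = 0. Proof. by rewrite innerC. Qed.
Let BFE p q : B (F p) (E q) = 0. Proof. by rewrite innerC. Qed.

Let half_eq (x y : R) : 2 * x = y -> x = 2^-1 * y.
Proof. by move=> <-; rewrite mulrA mulVf ?mul1r// pnatr_eq0. Qed.

Let frameB := (BZZ, BZE, BZF, BEE, BFF, BEF, BEZ, BFZ, BFE).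
Let brackets := (lie_bracketZr, lie_bracketEr, lie_bracketFr).

(** Every bracket is a multiple of the central vector [Z], so a Koszul term survives only when its
    bracket avoids [Z] and the vector paired with it has a [Z] component. Here and in the next five
    lemmas at most one of the three terms does. *)
Lemma nablaZE X q : B (nabla X Z) (E q) = 2^-1 * a q * B X (F q).
Proof.
rewrite (half_eq (koszul ip lc X Z (E q))) (lie_bracketC (E q)) !brackets.
by rewrite !(innerNl ip) !(innerZl ip) !(inner0l ip) !frameB; ring.
Qed.

Lemma nablaZF X q : B (nabla X Z) (F q) = - (2^-1 * a q * B X (E q)).
Proof.
rewrite (half_eq (koszul ip lc X Z (F q))) (lie_bracketC (F q)) !brackets.
by rewrite !(innerNl ip) !(innerZl ip) !(inner0l ip) !frameB; ring.
Qed.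

Lemma nablaEF X p q : B (nabla X (E p)) (F q) = - ((p == q)%:R * (2^-1 * a p * B X Z)).
Proof.
rewrite (half_eq (koszul ip lc X (E p) (F q))) (lie_bracketC (F q) X) !brackets.
rewrite !(innerNl ip) !(innerZl ip) !frameB (innerC ip Z X).
by case: eqP => [->|_] /=; ring.
Qed.

Lemma nablaEE X p q : B (nabla X (E p)) (E q) = 0.
Proof.
rewrite (half_eq (koszul ip lc X (E p) (E q))) (lie_bracketC (E q) X) !brackets.
by rewrite !(innerNl ip) !(innerZl ip) !frameB; ring.
Qed.

Lemma nablaFF X p q : B (nabla X (F p)) (F q) = 0.
Proof.
rewrite (half_eq (koszul ip lc X (F p) (F q))) (lie_bracketC (F q) X) !brackets.
by rewrite !(innerNl ip) !(innerZl ip) !frameB; ring.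
Qed.

(** For p = q the value is a_p g(X, Z) / 2, by skewness from [nablaEF]. In a sum over i < j this
    pair appears once, with [E p] first. *)
Lemma nablaFE X p q : p != q -> B (nabla X (F p)) (E q) = 0.
Proof.
move=> /negbTE pq.
rewrite (half_eq (koszul ip lc X (F p) (E q))) (lie_bracketC (E q) X) !brackets.
by rewrite !(innerNl ip) !(innerZl ip) !frameB pq /=; ring.
Qed.

(** * The spin connection *)

Let nthZ x0 : nth x0 e 0 = Z. Proof. by []. Qed.
Let nthE x0 (p : 'I_n) : nth x0 e p.*2.+1 = E p. Proof. exact: (frame_nth x0 Z E F p).1. Qed.
Let nthF x0 (p : 'I_n) : nth x0 e p.*2.+2 = F p. Proof. exact: (frame_nth x0 Z E F p).2. Qed.

Lemma cliffordZ (eta : Sigma R n) : clifford B e Z eta = 'i *: (even_part eta - odd_part eta).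
Proof.
rewrite /clifford nthZ BZZ scale1r big1 ?addr0// => p _.
by rewrite nthE nthF BZE BZF !scale0r addr0.
Qed.

Lemma cliffordE p (eta : Sigma R n) :
  clifford B e (E p) eta = 'i *: (xcontract p eta + ywedge p eta).
Proof.
rewrite /clifford nthZ BEZ scale0r add0r.
under eq_bigr => q _ do rewrite nthE nthF BEF BEE scale0r addr0.
rewrite (bigD1 p)//= eqxx scale1r big1 ?addr0// => q /negbTE qp.
by rewrite eq_sym qp scale0r.
Qed.

Lemma cliffordF p (eta : Sigma R n) : clifford B e (F p) eta = ywedge p eta - xcontract p eta.
Proof.
rewrite /clifford nthZ BFZ scale0r add0r.
under eq_bigr => q _ do rewrite nthE nthF BFE BFF scale0r add0r.
rewrite (bigD1 p)//= eqxx scale1r big1 ?addr0// => q /negbTE qp.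
by rewrite eq_sym qp scale0r.
Qed.

(** Among the pairs i < j only (Z, E_q), (Z, F_q) and (E_q, F_q) have a non-zero coefficient, and
    the double Clifford products on 1 are y_q, - i y_q and i. *)
Lemma spin_sum_one X :
  \sum_(i < n.*2.+1) \sum_(j < n.*2.+1 | (i < j)%N)
    (B (nabla X (tnth e i)) (tnth e j))%:C *:
      clifford B e (tnth e i) (clifford B e (tnth e j) (sigma_one R n)) =
  \sum_(q < n)
    ((B (nabla X Z) (E q))%:C *: sigma_y R q - ((B (nabla X Z) (F q))%:C * 'i) *: sigma_y R q
     + ((B (nabla X (E q)) (F q))%:C * 'i) *: sigma_one R n).
Proof.
(* [T] extends the summand by 0 to all pairs of natural numbers, so that both sums become full and
   split along the frame. The existential keeps [T] folded until [TE] is used. *)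
have [T TE] : exists T : nat -> nat -> Sigma R n, forall i j, T i j =
    if (i < j)%N then (B (nabla X e`_i) e`_j)%:C *:
      clifford B e e`_i (clifford B e e`_j (sigma_one R n)) else 0.
  by exists (fun i j => if (i < j)%N then (B (nabla X e`_i) e`_j)%:C *:
      clifford B e e`_i (clifford B e e`_j (sigma_one R n)) else 0).
transitivity (\sum_(i < n.*2.+1) \sum_(j < n.*2.+1) T i j).
  by apply: eq_bigr => i _; rewrite big_mkcond; apply: eq_bigr => j _; rewrite TE !(tnth_nth 0).
rewrite (big_frame_index _ (fun i => \sum_(j < n.*2.+1) T i j)).
rewrite (big_frame_index _ (T 0)).
rewrite TE ltnn add0r -big_split; apply: eq_bigr => p _ /=.
have cl_one : (clifford B e (E p) (sigma_one R n) = 'i *: sigma_y R p) *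
              (clifford B e (F p) (sigma_one R n) = sigma_y R p).
  by rewrite cliffordE cliffordF xcontract_one ywedge_one add0r subr0.
have -> : T 0 p.*2.+1 = (B (nabla X Z) (E p))%:C *: sigma_y R p.
  rewrite TE ltn0Sn nthZ nthE cl_one cliffordZ even_partZ odd_partZ -scalerBr even_odd_y.
  by rewrite scalerN scalerN scalerA -expr2 sqrCi scaleN1r opprK.
have -> : T 0 p.*2.+2 = - ((B (nabla X Z) (F p))%:C * 'i) *: sigma_y R p.
  by rewrite TE ltn0Sn nthZ nthF cl_one cliffordZ even_odd_y scalerN scalerN scaleNr scalerA.
rewrite (big_frame_index _ (T p.*2.+1)) (big_frame_index _ (T p.*2.+2)).
(* In the row of [E p] only the column of [F p] contributes. *)
have -> : \sum_(q < n) (T p.*2.+1 q.*2.+1 + T p.*2.+1 q.*2.+2) =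
    ((B (nabla X (E p)) (F p))%:C * 'i) *: sigma_one R n.
  under eq_bigr => q _ do rewrite !TE !nthE nthF nablaEE scale0r if_same add0r.
  rewrite (bigD1 p)//= big1 ?addr0 => [|q /negbTE qp]; last first.
    by rewrite nablaEF eq_sym qp mul0r oppr0 !scale0r !if_same.
  rewrite ltnSn cl_one cliffordE xcontract_y eqxx scale1r.
  by rewrite -ywedge_one ywedge_twice addr0 scalerA.
(* What is left vanishes: column 0 lies below the diagonal, the coefficients between two [F] vectors
   are 0, and in the row of [F p] the column of [E q] has coefficient 0 for q different from p and
   lies below the diagonal for q = p. *)
rewrite [T _ 0%N]TE [T _.*2.+2 0%N]TE !ltn0 add0r scaleNr big1 ?addr0 ?add0r//= => q _.
rewrite !TE !nthE !nthF nablaFF scale0r if_same addr0; case: ifP => //.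
have [->|pq] := eqVneq p q; first by rewrite ltnNge leqnSn.
by rewrite nablaFE// scale0r.
Qed.

Lemma spinor_deriv_invariant (eta : Sigma R n) h X :
  spinor_deriv (invariant_spinor eta) h X = 0.
Proof.
by apply/ffunP => S; rewrite !ffunE /invariant_spinor !derive1_cst.
Qed.

Let lambda p := 4^-1 * a p.
Let mu := - \sum_(q < n) lambda q.

Lemma spin_connection_one h X :
  spin_connection B nabla e (invariant_spinor (sigma_one R n)) h X =
  ((mu * B X Z)%:C * 'i) *: sigma_one R n +
  \sum_(p < n) ((lambda p * B X (E p))%:C * 'i + (lambda p * B X (F p))%:C) *: sigma_y R p.
Proof.
(* The factor 1/4 in the eigenvalues is one 1/2 from the lift to spinors times one 1/2 from the
   Koszul formula. *)
have half2 : 2^-1 * 2^-1 = 4^-1 :> R by rewrite -invfM -natrM.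
have halfC : 2^-1 = (2^-1)%:C :> R[i] by rewrite (fmorphV (real_complex R)) rmorph_nat.
rewrite /spin_connection spinor_deriv_invariant add0r /invariant_spinor spin_sum_one.
rewrite big_split scalerDr addrC /= halfC; congr (_ + _).
  rewrite -scaler_suml scalerA -mulr_suml mulrA -(rmorph_sum (real_complex R)) -rmorphM.
  congr (_%:C * _ *: _).
  (* Each plane (E_q, F_q) contributes - a_q / 4 to the coefficient of 1, and these add up to
     [mu]. *)
  rewrite mulNr mulr_suml mulr_sumr -sumrN; apply: eq_bigr => q _.
  by rewrite nablaEF eqxx mul1r mulrN !mulrA half2.
rewrite scaler_sumr; apply: eq_bigr => q _.
rewrite nablaZE nablaZF rmorphN mulNr scaleNr opprK -scalerDl scalerA; congr (_ *: _).
by rewrite mulrDr addrC mulrA -!rmorphM !mulrA half2.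
Qed.

(** Through this injectivity the Killing equation at a single point determines the endomorphism
    there. *)
Lemma clifford_one_inj X Y :
  clifford B e X (sigma_one R n) = clifford B e Y (sigma_one R n) -> X = Y.
Proof.
rewrite !clifford_one nthZ.
under eq_bigr do rewrite nthE nthF; under [in RHS]eq_bigr do rewrite nthE nthF.
move=> /sigma_comb_inj[XZ XEF]; rewrite (heis_expand X) (heis_expand Y) XZ; congr (_ + _).
by apply: eq_bigr => p _; rewrite (XEF p).1 (XEF p).2.
Qed.

(** * The diagonal endomorphism A and its eigenvalues *)

Definition adapted_endo X :=
  (mu * B X Z) *: Z + \sum_p ((lambda p * B X (E p)) *: E p + (lambda p * B X (F p)) *: F p).

Lemma adapted_endo_is_linear : linear adapted_endo.
Proof.
move=> c X Y; rewrite /adapted_endo scalerDr addrACA scaler_sumr -big_split /=.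
rewrite !(innerDl ip) !(innerZl ip); congr (_ + _).
  by rewrite scalerA -scalerDl; congr (_ *: _); ring.
apply: eq_bigr => p _; rewrite !(innerDl ip) !(innerZl ip) scalerDr !scalerA.
rewrite addrACA -!scalerDl.
by rewrite !mulrDr !(mulrCA c).
Qed.

Lemma adapted_endo_coord X :
  [/\ B (adapted_endo X) Z = mu * B X Z,
      forall p, B (adapted_endo X) (E p) = lambda p * B X (E p)
    & forall p, B (adapted_endo X) (F p) = lambda p * B X (F p)].
Proof.
split=> [|p|p]; rewrite (innerDl ip) (innerZl ip) (inner_suml ip) !frameB.
- rewrite mulr1 big1 ?addr0// => p _.
  by rewrite (innerDl ip) !(innerZl ip) !frameB !mulr0 addr0.
- rewrite mulr0 add0r (bigD1 p)//= big1 ?addr0 => [|q /negbTE qp].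
    by rewrite (innerDl ip) !(innerZl ip) !frameB eqxx mulr1 mulr0 addr0.
  by rewrite (innerDl ip) !(innerZl ip) !frameB qp !mulr0 addr0.
- rewrite mulr0 add0r (bigD1 p)//= big1 ?addr0 => [|q /negbTE qp].
    by rewrite (innerDl ip) !(innerZl ip) !frameB eqxx mulr1 mulr0 add0r.
  by rewrite (innerDl ip) !(innerZl ip) !frameB qp !mulr0 addr0.
Qed.

Lemma clifford_adapted_endo h X :
  spin_connection B nabla e (invariant_spinor (sigma_one R n)) h X =
  clifford B e (adapted_endo X) (sigma_one R n).
Proof.
have [AZ AE AF] := adapted_endo_coord X.
rewrite spin_connection_one clifford_one nthZ AZ; congr (_ + _).
by apply: eq_bigr => p _; rewrite nthE nthF AE AF.
Qed.

(** Applied to an eigenvector, this provides a coordinate by which the eigenvalue equation can be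
    divided. *)
Lemma inner_frame_neq0 X : X != 0 ->
  B X Z != 0 \/ exists p, B X (E p) != 0 \/ B X (F p) != 0.
Proof.
move=> /eqP X0; have [Z0|] := eqVneq (B X Z) 0; last by left.
right; apply: contrapT => nex; apply: X0.
rewrite (heis_expand X) Z0 scale0r add0r big1// => p _.
have [-> |Ep] := eqVneq (B X (E p)) 0; last by case: nex; exists p; left.
have [-> |Fp] := eqVneq (B X (F p)) 0; last by case: nex; exists p; right.
by rewrite !scale0r addr0.
Qed.

(** The eigenspace is the kernel of A - l as a subspace, and [vpick] returns a non-zero vector of
    any non-zero subspace. *)
Lemma leigenvalueP (A : 'End(heis R n)) l :
  passmx.leigenvalue A l <-> exists2 X, X != 0 & A X = l *: X.
Proof.
have kerE X : (X \in passmx.leigenspace A l) = (A X == l *: X).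
  by rewrite memv_ker add_lfunE opp_lfunE scale_lfunE id_lfunE subr_eq0.
split=> [A0|[X X0 AX]].
  exists (vpick (passmx.leigenspace A l)); first by rewrite vpick0.
  by apply/eqP; rewrite -kerE memv_pick.
apply: contra X0 => /eqP A0.
by rewrite -memv0 -A0 kerE AX.
Qed.

(** Pairing A X = l X with a frame vector on which X has a non-zero coordinate forces l to be the
    corresponding diagonal entry. Conversely, [E p] and [Z] are eigenvectors for [lambda p] and
    [mu]. *)
Lemma adapted_endo_eigenvalues (A : 'End(heis R n)) : A =1 adapted_endo ->
  [set l | passmx.leigenvalue A l] = range lambda `|` [set mu].
Proof.
move=> AE; apply/seteqP; split=> l /=; rewrite leigenvalueP.
  move=> [X X0]; rewrite AE => AX; have [AZ AEp AF] := adapted_endo_coord X.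
  have := inner_frame_neq0 X0; move: AZ AEp AF; rewrite AX (innerZl ip) => AZ AEp AF.
  case=> [XZ|[p [XE|XF]]]; [right|left; exists p => //|left; exists p => //].
  - exact: (mulIf XZ).
  - by apply: (mulIf XE); rewrite -AEp (innerZl ip).
  - by apply: (mulIf XF); rewrite -AF (innerZl ip).
have neq0 X : B X X = 1 -> X != 0.
  by move=> BX; apply/eqP => X0; move/eqP: BX; rewrite X0 (inner0l ip) eq_sym oner_eq0.
move=> [[p _ <-]|->].
  exists (E p); first by rewrite neq0// BEE eqxx.
  rewrite AE /adapted_endo !frameB mulr0 scale0r add0r (bigD1 p)//=.
  rewrite big1 ?addr0 => [|q /negbTE qp].
    by rewrite !frameB eqxx mulr1 mulr0 scale0r addr0.
  by rewrite !frameB eq_sym qp !mulr0 !scale0r addr0.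
exists Z; first by rewrite neq0.
rewrite AE /adapted_endo !frameB mulr1 big1 ?addr0// => p _.
by rewrite !frameB !mulr0 !scale0r addr0.
Qed.

(** The induction is over all constants [c], because the directional derivatives are the constant
    0. *)
Lemma Ck_cst (V : normedModType R) k (c : R) : Ck k (fun _ : V => c).
Proof.
elim: k c => [|k IHk] c /=; first by split=> //; exact: cst_continuous.
split; first exact: cst_continuous.
move=> v; split; first by move=> x; exact: derivable_cst.
have -> : (fun x => 'D_v (fun _ : V => c) x) = fun=> 0.
  by apply/funext => x; exact: derive_cst.
exact: IHk.
Qed.

Lemma adapted_killing_endo (A : 'End(heis R n)) : A =1 adapted_endo ->
  killing_endo B nabla e (invariant_spinor (sigma_one R n)) (fun=> A).
Proof.
move=> AE; split; last by move=> h _ X; rewrite AE clifford_adapted_endo.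
split; first by move=> i j k; exact: Ck_cst.
move=> h _ X Y; rewrite !AE (innerC ip X) /adapted_endo.
(* Both sides become the same diagonal bilinear form in the coordinates of [X] and [Y]. *)
rewrite !(innerDl ip) !(innerZl ip) !(inner_suml ip) !(innerC ip Z); congr (_ + _); first by ring.
apply: eq_bigr => p _; rewrite !(innerDl ip) !(innerZl ip) !(innerC ip (E p)) !(innerC ip (F p)).
by ring.
Qed.

Lemma invariant_one_killing :
  generalised_killing B nabla e (invariant_spinor (sigma_one R n)).
Proof.
split; first by move=> S; split=> k; exact: Ck_cst.
pose A : {linear heis R n -> heis R n} := HB.pack adapted_endo
  (GRing.isLinear.Build _ _ _ _ adapted_endo adapted_endo_is_linear).
by exists (fun=> linfun A); apply: adapted_killing_endo => X; rewrite lfunE.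
Qed.

(** Any field A solving the Killing equation satisfies A(X).1 = [adapted_endo] X.1 at each point of
    the group, so injectivity of the action on 1 identifies the two endomorphisms there. *)
Lemma invariant_one_eigenvalues :
  constant_eigenvalues B nabla e (invariant_spinor (sigma_one R n))
    (range lambda `|` [set mu]).
Proof.
move=> A [_ AK] h hG; apply: adapted_endo_eigenvalues => X.
by apply: clifford_one_inj; rewrite -(clifford_adapted_endo h) AK.
Qed.
End AdaptedBasis.

(** * Existence of adapted bases *)

Section HatFrame.
Variables (R : realType) (n : nat).
Local Notation hat := (hat_frame R n).

(** The hat matrices have their non-zero entries in pairwise distinct positions, so coordinates can
    be read off as matrix entries. Both freeness and the coordinate formula on the Lie algebra rest
    on this. *)
Lemma hat_entries (z : R) (x y : 'I_n -> R) :
  let M := z *: hatZ R n + \sum_p (x p *: hatE R p + y p *: hatF R p) in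
  [/\ M (ifst n) (ilst n) = z, forall p, M (ifst n) (imid p) = x p
    & forall p, M (imid p) (ilst n) = y p].
Proof.
have ml (p : 'I_n) : (imid p == ilst n) = false.
  by rewrite /imid /ilst (inj_eq (@rshift_inj _ _)) eq_lrshift.
have mf (p : 'I_n) : (imid p == ifst n) = false by [].
have fl : (ifst n == ilst n) = false by [].
have lf : (ilst n == ifst n) = false by [].
have fm (p : 'I_n) : (ifst n == imid p) = false by [].
have lm (p : 'I_n) : (ilst n == imid p) = false by rewrite eq_sym ml.
have mm (p q : 'I_n) : (imid p == imid q) = (p == q).
  by rewrite /imid (inj_eq (@rshift_inj _ _)) (inj_eq (@lshift_inj _ _)).
have sumE (p : 'I_n) (u : 'I_n -> R) : \sum_q u q * (p == q)%:R = u p.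
  rewrite (bigD1 p)//= eqxx mulr1 big1 ?addr0// => q /negbTE qp.
  by rewrite eq_sym qp mulr0.
move=> M; have entry i j : M i j = z * ((i == ifst n) && (j == ilst n))%:R +
    \sum_p (x p * ((i == ifst n) && (j == imid p))%:R +
            y p * ((i == imid p) && (j == ilst n))%:R).
  by rewrite /M !mxE summxE; congr (_ + _); apply: eq_bigr => p _; rewrite !mxE.
have eqE := (fl, lf, mf, fm, ml, lm, eqxx).
split=> [|p|p]; rewrite entry !eqE /= ?mulr1 ?mulr0 ?add0r.
- by rewrite big1 ?addr0// => p _; rewrite ?eqE /= !mulr0 addr0.
- by rewrite -[RHS](sumE p x); apply: eq_bigr => q _; rewrite ?eqE mm /= mulr0 addr0.
- by rewrite -[RHS](sumE p y); apply: eq_bigr => q _; rewrite ?eqE mm andbT /= mulr0 add0r.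
Qed.

Lemma hat_sum (k : nat -> R) : \sum_(i < n.*2.+1) k i *: hat`_i =
  k 0%N *: hatZ R n + \sum_(p < n) (k p.*2.+1 *: hatE R p + k p.*2.+2 *: hatF R p).
Proof.
rewrite (big_frame_index _ (fun i => k i *: hat`_i)); congr (_ + _).
by apply: eq_bigr => p _; rewrite (frame_nth 0 _ _ _ p).1 (frame_nth 0 _ _ _ p).2.
Qed.

Lemma hat_free : free hat.
Proof.
(* [k'] extends the coefficients to natural numbers; its default 0 is never reached below the size
   of the frame. *)
apply/freeP => k; pose k' i := if insub i is Some j then k j else 0.
rewrite (eq_bigr (fun i : 'I__ => k' i *: hat`_i)) => [|i _]; last by rewrite /k' valK.
rewrite hat_sum => k0 i; have -> : k i = k' i by rewrite /k' valK.
have [] := hat_entries (k' 0%N) (fun p : 'I_n => k' p.*2.+1) (fun p : 'I_n => k' p.*2.+2).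
rewrite k0 => kZ kE kF.
have [->|[p [->|->]]] := frame_index (ltn_ord i).
- by rewrite -kZ mxE.
- by rewrite -kE mxE.
- by rewrite -kF mxE.
Qed.

Lemma heis_algE (X : heis R n) :
  let M := vsval X in
  M = M (ifst n) (ilst n) *: hatZ R n +
      \sum_p (M (ifst n) (imid p) *: hatE R p + M (imid p) (ilst n) *: hatF R p).
Proof.
have := coord_span (subvsP X); set k := fun i => coord hat i (vsval X).
pose k' i := if insub i is Some j then k j else 0.
rewrite (eq_bigr (fun i : 'I__ => k' i *: hat`_i)) => [|i _]; last by rewrite /k' valK.
rewrite hat_sum => XE /=.
have [] := hat_entries (k' 0%N) (fun p : 'I_n => k' p.*2.+1) (fun p : 'I_n => k' p.*2.+2).
rewrite -XE => -> kE kF; rewrite {1}XE; congr (_ + _).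
by apply: eq_bigr => p _; rewrite kE kF.
Qed.

Variable a : 'I_n -> R.
Hypothesis a_gt0 : forall p, 0 < a p.

Let z (X : heis R n) : R := vsval X (ifst n) (ilst n).
Let x (X : heis R n) p : R := vsval X (ifst n) (imid p).
Let y (X : heis R n) p : R := vsval X (imid p) (ilst n).

(** Dividing by the square of [a p] gives a_p times the p-th E matrix unit length. *)
Definition scaled_inner (X Y : heis R n) : R :=
  z X * z Y + \sum_p (x X p * x Y p / a p ^+ 2 + y X p * y Y p).

Lemma scaled_inner_product : inner_product scaled_inner.
Proof.
split=> [c X Y W|X Y|X X0].
- rewrite /scaled_inner mulrDr addrACA mulr_sumr -big_split /=; congr (_ + _).
    by rewrite /z linearP !mxE; ring.
  by apply: eq_bigr => p _; rewrite /x /y linearP !mxE; ring.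
- by rewrite /scaled_inner mulrC; congr (_ + _); apply: eq_bigr => p _; ring.
have term_ge0 p : 0 <= x X p * x X p / a p ^+ 2 + y X p * y X p.
  by rewrite addr_ge0 ?divr_ge0 ?sqr_ge0 -?expr2 ?sqr_ge0.
rewrite lt_neqAle addr_ge0 -?expr2 ?sqr_ge0 ?sumr_ge0// andbT eq_sym.
apply: contra X0; rewrite paddr_eq0 ?sqr_ge0 ?sumr_ge0// sqrf_eq0 => /andP[/eqP zX].
(* A vanishing sum of squares makes every matrix coordinate of [X] vanish. *)
rewrite psumr_eq0// => /allP xy0; apply/eqP/val_inj; rewrite /= [LHS]heis_algE.
rewrite -/(z X) zX scale0r add0r big1// => p _.
have := xy0 p (mem_index_enum p); rewrite paddr_eq0 ?divr_ge0 ?sqr_ge0 -?expr2 ?sqr_ge0//.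
rewrite mulf_eq0 invr_eq0 !sqrf_eq0 (gt_eqF (a_gt0 p)) orbF => /andP[/eqP xX /eqP yX].
by rewrite -/(x X p) -/(y X p) xX yX !scale0r addr0.
Qed.

Let Z := vsproj (heis_alg R n) (hatZ R n).
Let E p := a p *: vsproj (heis_alg R n) (hatE R p).
Let F p := vsproj (heis_alg R n) (hatF R p).

(** Rescaling the E vectors alone multiplies the bracket [E_p, F_p] by a_p and makes the transition
    matrix from the hat frame diagonal with positive entries 1, a_1, 1, a_2, 1 and so on, hence
    positively oriented. *)
Lemma scaled_heis_basis : heis_basis scaled_inner Z E F a.
Proof.
have [Zin EFin] := frame_mem (hatZ R n) (@hatE R n) (@hatF R n).
have vZ : vsval Z = hatZ R n by rewrite vsprojK// memv_span.
have vE p : vsval (E p) = a p *: hatE R p.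
  by rewrite linearZ /= vsprojK// memv_span//; case: (EFin p).
have vF p : vsval (F p) = hatF R p by rewrite vsprojK// memv_span//; case: (EFin p).
have entries (X : heis R n) c (u v : 'I_n -> R) :
    vsval X = c *: hatZ R n + \sum_p (u p *: hatE R p + v p *: hatF R p) ->
    [/\ z X = c, x X =1 u & y X =1 v].
  by rewrite /z /x /y => ->; exact: hat_entries.
have [zZ xZ yZ] : [/\ z Z = 1, x Z =1 (fun=> 0) & y Z =1 (fun=> 0)].
  by apply: entries; rewrite vZ scale1r big1 ?addr0// => p _; rewrite !scale0r addr0.
have exyE p : [/\ z (E p) = 0, x (E p) =1 (fun q => (p == q)%:R * a p) & y (E p) =1 (fun=> 0)].
  apply: entries; rewrite vE scale0r add0r (bigD1 p)//= eqxx mul1r scale0r addr0 big1 ?addr0//.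
  by move=> q /negbTE qp; rewrite eq_sym qp mul0r !scale0r addr0.
have exyF p : [/\ z (F p) = 0, x (F p) =1 (fun=> 0) & y (F p) =1 (fun q => (p == q)%:R)].
  apply: entries; rewrite vF scale0r add0r (bigD1 p)//= eqxx scale1r scale0r add0r big1 ?addr0//.
  by move=> q /negbTE qp; rewrite eq_sym qp !scale0r addr0.
have [ip_lin sym _] := scaled_inner_product.
have [EF ZZ EE FF FE] := hat_mul R n.
split.
- apply/orthonormal_frameP => //; split=> [|p|p|p q|]; last split=> p q; rewrite /scaled_inner.
  + by rewrite zZ big1 ?addr0 ?mulr1// => p _; rewrite xZ yZ !mul0r addr0.
  + have [zE xE yE] := exyE p.
    by rewrite zE mulr0 add0r big1// => q _; rewrite xZ yZ !mul0r addr0.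
  + have [zF xF yF] := exyF p.
    by rewrite zF mulr0 add0r big1// => q _; rewrite xZ yZ !mul0r addr0.
  + have [zE xE yE] := exyE p; have [zE' xE' yE'] := exyE q.
    rewrite zE mul0r add0r (bigD1 p)//= big1 ?addr0 => [|r /negbTE rp]; rewrite xE xE' yE.
      rewrite mul0r addr0 eqxx eq_sym; case: eqP => [<-|_] /=; last by rewrite mul0r mulr0 mul0r.
      by rewrite !mul1r -expr2 divff// sqrf_eq0 gt_eqF.
    by rewrite eq_sym rp !mul0r addr0.
  + have [zF xF yF] := exyF p; have [zF' xF' yF'] := exyF q.
    rewrite zF mul0r add0r (bigD1 p)//= big1 ?addr0 => [|r /negbTE rp]; rewrite xF yF yF'.
      by rewrite !mul0r add0r eqxx mul1r eq_sym.
    by rewrite [p == r]eq_sym rp !mul0r addr0.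
  + have [zE xE yE] := exyE p; have [zF xF yF] := exyF q.
    by rewrite zE mul0r add0r big1// => r _; rewrite xF yE mulr0 !mul0r addr0.
(* The diagonal of the transition matrix is itself arranged as a frame of scalars. *)
- have eH (i : 'I_n.*2.+1) :
      vsval (tnth (frame Z E F) i) = tnth (frame 1 a (fun=> 1)) i *: hat`_i.
    rewrite !(tnth_nth 0); have [->|[p [->|->]]] := frame_index (ltn_ord i).
    + by rewrite vZ scale1r.
    + by rewrite !(frame_nth _ _ _ _ p).1 vE.
    + by rewrite !(frame_nth _ _ _ _ p).2 vF scale1r.
  rewrite /positively_oriented.
  have -> : \matrix_(i, j) coord hat j (vsval (tnth (frame Z E F) i)) =
      diag_mx (\row_i tnth (frame 1 a (fun=> 1)) i).
    by apply/matrixP => i j; rewrite !mxE eH linearZ /= coord_free ?hat_free// mulr_natr.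
  rewrite det_diag prodr_gt0// => i _; rewrite mxE (tnth_nth 0).
  by have [->|[p [->|->]]] := frame_index (ltn_ord i);
    rewrite ?(frame_nth _ _ _ _ p).1 ?(frame_nth _ _ _ _ p).2.
- move=> p q; apply: val_inj; rewrite /= lie_bracketE vE vF vZ.
  rewrite -scalemxAl -scalemxAr EF FE scaler0 subr0 scalerA mulrC.
  by case: eqP => [->|_]//; rewrite !mul0r.
- move=> p; split; apply: val_inj; rewrite /= lie_bracketE ?vE ?vF vZ /=.
    by have [ZE EZ] := ZZ _ (EFin p).1; rewrite -scalemxAl -scalemxAr ZE EZ scaler0 subrr.
  by have [ZF FZ] := ZZ _ (EFin p).2; rewrite ZF FZ subrr.
- move=> p q; split; apply: val_inj; rewrite /= lie_bracketE ?vE ?vF.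
    by rewrite -!scalemxAl -!scalemxAr !EE !scaler0 subrr.
  by rewrite !FF subrr.
Qed.
End HatFrame.

(** * Counting the eigenvalues *)

Lemma card_eigenvalues (R : realType) (n : nat) (lambda : nat -> R) :
  (0 < n)%N -> injective lambda -> (forall k, 0 < lambda k) ->
  range (fun p : 'I_n => lambda p) `|` [set - \sum_(q < n) lambda q] #= `I_n.+1.
Proof.
move=> n_gt0 inj_l l_gt0; set mu := - _.
(* As n is positive the sum has a positive term, so [mu] is negative and differs from every
   [lambda k]. *)
have mu_lt0 : mu < 0.
  rewrite oppr_lt0 (bigD1 (Ordinal n_gt0))//=.
  by apply: ltr_pwDl => //; apply: sumr_ge0 => q _; exact: ltW.
(* [g] enumerates the set along 0, ..., n, with [mu] in the last place. *)
pose g k := if (k < n)%N then lambda k else mu.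
suff -> : range (fun p : 'I_n => lambda p) `|` [set mu] = g @` `I_n.+1.
  apply: inj_card_eq => i j /set_mem /= ilt /set_mem /= jlt; rewrite /g.
  have lmu k : lambda k <> mu by move=> lE; have := l_gt0 k; rewrite lE ltNge ltW.
  case: ltnP => ni; case: ltnP => nj; first exact: inj_l.
  - by move=> /lmu.
  - by move=> /esym/lmu.
  - by move=> _; apply/eqP;
    rewrite eqn_leq (leq_trans (ilt : (i <= n)%N) nj) (leq_trans (jlt : (j <= n)%N) ni).
rewrite /g; apply/seteqP; split=> [l [[p _ <-]|->]|l [k /= kn <-]].
- by exists (p : nat); rewrite /= ?ltn_ord// ltnW// ltnS ltn_ord.
- by exists n; rewrite //= ltnn.
- by case: ltnP => kn'; [left; exists (Ordinal kn')|right].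
Qed.

(** The middle conjunct shows that the choice a_p = p is realised by some metric, so the count of n
    + 1 eigenvalues in the last one is not vacuous. The indices start at 0, hence [p.+1]. *)
Theorem theorem3p3 (R : realType) (n : nat) (n_gt0 : (0 < n)%N) :
  (forall (B : heis R n -> heis R n -> R)
          (nabla : heis R n -> heis R n -> heis R n)
          (Z : heis R n) (E F : 'I_n -> heis R n) (a : 'I_n -> R),
     inner_product B -> levi_civita B nabla ->
     (forall p, 0 < a p) -> heis_basis B Z E F a ->
     let e := frame Z E F in
     let psi := invariant_spinor (sigma_one R n) in
     let lambda p := 4^-1 * a p in
     let mu := - \sum_(q < n) lambda q in
     generalised_killing B nabla e psi /\
     constant_eigenvalues B nabla e psi (range lambda `|` [set mu]))
  /\
  (exists (B : heis R n -> heis R n -> R)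
          (nabla : heis R n -> heis R n -> heis R n)
          (Z : heis R n) (E F : 'I_n -> heis R n),
     [/\ inner_product B, levi_civita B nabla
       & heis_basis B Z E F (fun p => p.+1%:R)])
  /\
  (forall (B : heis R n -> heis R n -> R)
          (nabla : heis R n -> heis R n -> heis R n)
          (Z : heis R n) (E F : 'I_n -> heis R n),
     inner_product B -> levi_civita B nabla ->
     heis_basis B Z E F (fun p => p.+1%:R) ->
     let e := frame Z E F in
     let psi := invariant_spinor (sigma_one R n) in
     exists L : set R,
       [/\ L #= `I_n.+1, generalised_killing B nabla e psi
         & constant_eigenvalues B nabla e psi L]).
Proof.
split=> [B nabla Z E F a ip lc _ basis|].
  by split; [exact: invariant_one_killing basis|exact: invariant_one_eigenvalues basis].
split=> [|B nabla Z E F ip lc basis].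
  have a_gt0 (p : 'I_n) : 0 < p.+1%:R :> R by rewrite ltr0Sn.
  have ip := scaled_inner_product a_gt0; have basis := scaled_heis_basis a_gt0.
  have [on _ _ _ _] := basis; have [nabla lc] := levi_civita_exists ip on.
  exact: (ex_intro _ _ (ex_intro _ _ (ex_intro _ _ (ex_intro _ _
    (ex_intro _ _ (And3 ip lc basis)))))).
(* The set [L] is left open and filled in by [invariant_one_eigenvalues]; its cardinality is then
   the remaining goal. *)
eexists; split; [|exact: invariant_one_killing basis|exact: invariant_one_eigenvalues basis].
apply: (@card_eigenvalues R n (fun k => 4^-1 * k.+1%:R)) => // i j.
have n4 : 4^-1 != 0 :> R by rewrite invr_eq0 pnatr_eq0.
by move=> /(mulfI n4) /eqP; rewrite eqr_nat eqSS => /eqP.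
Qed.
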